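(* For every integer $k\ge 0$, $|\mathcal{U}_{2k+1}(132,3421)|=\binom{2k-1}{k}$ (with the convention $\binom{-1}{0}=1$).
   Context: West's stack-sorting map $s$ is defined recursively on finite sequences of distinct positive integers: $s$ sends the empty sequence to itself, and if $\pi$ is a nonempty such sequence with largest entry $n$, writing $\pi=LnR$ one sets $s(\pi)=s(L)s(R)n$. A permutation $\pi\in S_n$ (one-line notation) is uniquely sorted if exactly one permutation $\sigma\in S_n$ satisfies $s(\sigma)=\pi$. Let $\mathcal{U}_n$ be the set of uniquely sorted permutations in $S_n$. A permutation $\pi$ contains a pattern $\tau\in S_m$ if some subsequence of $\pi$ of length $m$ has its entries in the same relative order as $\tau$; otherwise $\pi$ avoids $\tau$. $\mathcal{U}_{n}(\tau^{(1)},\dots,\tau^{(\ell)})$ denotes the set of permutations in $\mathcal{U}_n$ avoiding all of $\tau^{(1)},\dots,\tau^{(\ell)}$. *)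

(* Defs.v *)
From mathcomp Require Import all_boot perm.

Set Implicit Arguments.
Unset Strict Implicit.
Unset Printing Implicit Defensive.

Definition seqmax (w : seq nat) : nat := \max_(x <- w) x.

(* [fuel] bounds the recursion depth; by [stack_sort_cat] below, [size w] is
   enough for the defining recursion s(L n R) = s(L) s(R) n. *)
Fixpoint stack_sort_rec (fuel : nat) (w : seq nat) : seq nat :=
  if fuel is fuel'.+1 then
    if w is [::] then [::] else
    let n := seqmax w in
    let L := take (index n w) w in
    let R := drop (index n w).+1 w in
    stack_sort_rec fuel' L ++ stack_sort_rec fuel' R ++ [:: n]
  else [::].

Definition stack_sort (w : seq nat) : seq nat := stack_sort_rec (size w) w.

Lemma stack_sort_nil : stack_sort [::] = [::].
Proof. by []. Qed.

Lemma seqmax_mem (a : nat) (w : seq nat) : seqmax (a :: w) \in a :: w.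
Proof.
rewrite /seqmax; elim: w a => [|b w IH] a; first by rewrite big_seq1 mem_head.
rewrite big_cons; case: leqP => _; last exact: mem_head.
by rewrite inE IH orbT.
Qed.

Lemma stack_sort_rec_fuel (f g : nat) (w : seq nat) :
  size w <= f -> size w <= g -> stack_sort_rec f w = stack_sort_rec g w.
Proof.
elim: f g w => [|f IH] [|g] [|a w] // sf sg.
have := seqmax_mem a w; rewrite -index_mem [LHS]/= [RHS]/=.
set i := index _ _ => lti.
have sL : size (take i (a :: w)) <= size w by rewrite size_take lti -ltnS.
have sR : size (drop i.+1 (a :: w)) <= size w.
  by rewrite size_drop subSS leq_subr.
congr (_ ++ _); first by apply: IH; apply: leq_trans sL _.
by congr (_ ++ _); apply: IH; apply: leq_trans sR _.
Qed.

Lemma seqmax_split (L R : seq nat) (n : nat) :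
  all (fun x => x < n) L -> all (fun x => x < n) R ->
  seqmax (L ++ n :: R) = n /\ index n (L ++ n :: R) = size L.
Proof.
move=> /allP ltL /allP ltR; split; last first.
  by rewrite index_cat ifN /= ?eqxx ?addn0 //; apply/negP => /ltL; rewrite ltnn.
apply/eqP; rewrite eqn_leq /seqmax; apply/andP; split; last first.
  by apply: (leq_bigmax_seq (F := id)); rewrite // mem_cat inE eqxx orbT.
apply/bigmax_leqP_seq => x; rewrite mem_cat inE => + _.
by case/or3P => [/ltL/ltnW|/eqP->|/ltR/ltnW].
Qed.

Lemma stack_sort_cat (L R : seq nat) (n : nat) :
  all (fun x => x < n) L -> all (fun x => x < n) R ->
  stack_sort (L ++ n :: R) = stack_sort L ++ stack_sort R ++ [:: n].
Proof.
move=> ltL ltR; have [maxE idxE] := seqmax_split ltL ltR.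
rewrite /stack_sort size_cat /= addnS.
set f := size L + size R.
have -> : stack_sort_rec f.+1 (L ++ n :: R) =
  let w := L ++ n :: R in let m := seqmax w in
  stack_sort_rec f (take (index m w) w) ++
  stack_sort_rec f (drop (index m w).+1 w) ++ [:: m] by case: (L).
have dropE : drop (size L).+1 (L ++ n :: R) = R.
  by rewrite -cat_rcons drop_size_cat ?size_rcons.
rewrite /= maxE idxE take_size_cat // dropE.
by rewrite (@stack_sort_rec_fuel f (size L)) ?leq_addr //
  (@stack_sort_rec_fuel f (size R)) ?leq_addl.
Qed.

(* One-line notation, with entries 1, ..., n. *)
Definition word (n : nat) (p : 'S_n) : seq nat :=
  [seq (p i : nat).+1 | i <- enum 'I_n].

Definition order_iso (u v : seq nat) : bool :=
  (size u == size v) &&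
  [forall i : 'I_(size v), forall j : 'I_(size v),
     (nth 0 u i < nth 0 u j) == (nth 0 v i < nth 0 v j)].

Definition contains (w t : seq nat) : bool :=
  [exists m : (size w).-tuple bool, order_iso (mask m w) t].

Lemma containsP (w t : seq nat) :
  reflect (exists2 u, subseq u w & order_iso u t) (contains w t).
Proof.
apply: (iffP existsP) => [[m iso]|[u /subseqP[m sm ->] iso]].
  by exists (mask m w); rewrite ?mask_subseq.
by exists (tcast sm (in_tuple m)); rewrite val_tcast.
Qed.

Definition avoids (w : seq nat) (ts : seq (seq nat)) : bool :=
  all (fun t => ~~ contains w t) ts.

Definition uniquely_sorted (n : nat) (p : 'S_n) : bool :=
  #|[set q : 'S_n | stack_sort (word q) == word p]| == 1.

Definition uniquely_sorted_avoiding (n : nat) (ts : seq (seq nat)) :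
    {set 'S_n} :=
  [set p : 'S_n | uniquely_sorted p && avoids (word p) ts].

(* Main.v *)
Require Import Defs.
From mathcomp Require Import all_boot perm zify.

Set Implicit Arguments.
Unset Strict Implicit.
Unset Printing Implicit Defensive.

(* A preimage of u m is L m R with u = s(L) s(R), so preimages of a word are
   counted by cutting u in two and recursing.  Counting descents shows that a
   word has exactly one preimage iff it is built from single letters by joining
   two such words A, B with last A > head B into A B m, m maximal.  If such a
   word of length 2k+1 > 1 avoids 132 and 3421, the recursion only allows
     d_1 > ... > d_j > c < x_1 < ... < x_p, 1, g < y_1 < ... < y_q
   with p + q = j = k - 1, x_p < g, and d_i smaller than the i-th largest of the
   x's and y's.  Deleting 1, c = 2 and g leaves a ballot sequence of length 2j,
   and g may take any of 2j+1 values, giving (2j+1) Cat(j) = C(2k-1, k). *)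

(** * West's stack-sorting preimages *)

Lemma cat_eq_cat (T : Type) (s t A B : seq T) :
  s ++ t = A ++ B ->
  (exists2 C, A = s ++ C & t = C ++ B) \/ (exists2 C, s = A ++ C & B = C ++ t).
Proof.
elim: s A => [|x s IH] [|y A] /=; first by move=> ->; left; exists [::].
- by move=> ->; left; exists (y :: A).
- by move=> <-; right; exists (x :: s).
case=> <- /IH[[C -> ->]|[C -> ->]]; first by left; exists C.
by right; exists C.
Qed.

Lemma cat_cons_inj (T : eqType) (m : T) (X1 X2 Y1 Y2 : seq T) :
  m \notin X1 -> m \notin X2 -> X1 ++ m :: Y1 = X2 ++ m :: Y2 ->
  X1 = X2 /\ Y1 = Y2.
Proof.
move=> n1 n2 e; have iE X Y : m \notin X -> index m (X ++ m :: Y) = size X.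
  by move=> nX; rewrite index_cat (negbTE nX) /= eqxx addn0.
have sz : size X1 = size X2 by rewrite -(iE X1 Y1) // e iE.
by move/eqP: e; rewrite eqseq_cat // => /andP[/eqP-> /eqP[->]].
Qed.

Lemma max_split (w : seq nat) : uniq w -> w != [::] ->
  exists L n R, [/\ w = L ++ n :: R, all (fun x => x < n) L
                  & all (fun x => x < n) R].
Proof.
case: w => // a w; set s := a :: w => us _.
have := seqmax_mem a w; rewrite -/s; set n := seqmax _ => ns.
have le x : x \in s -> x <= n.
  by move=> xs; apply: (leq_bigmax_seq (F := id)).
case/splitPr: ns us le => L R;
  rewrite cat_uniq /= => /and3P[_ + /andP[nR _]] le.
rewrite negb_or => /andP[nL _].
exists L, n, R; split=> //; apply/allP => x xs; rewrite ltn_neqAle le.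
- by rewrite andbT; apply: contraNneq nL => <-.
- by rewrite mem_cat xs.
- by rewrite andbT; apply: contraNneq nR => <-.
- by rewrite mem_cat inE xs !orbT.
Qed.

Lemma stack_sort_perm (w : seq nat) : uniq w -> perm_eq (stack_sort w) w.
Proof.
have [n] := ubnP (size w); elim: n w => // n IH w sw uw.
have [-> //|/(max_split uw)[L [m [R [e ltL ltR]]]]] := eqVneq w [::].
move: sw uw; rewrite e size_cat /= cat_uniq /= => sw /and3P[uL _ /andP[_ uR]].
rewrite stack_sort_cat // cats1.
have [pL pR] : perm_eq (stack_sort L) L /\ perm_eq (stack_sort R) R.
  by split; apply: IH => //; lia.
by apply: perm_cat; rewrite // perm_rcons perm_cons.
Qed.

(** * The image of the stack-sorting map *)

Definition sortable (w : seq nat) : Prop :=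
  exists2 v, uniq v & stack_sort v = w.

(** Preimages range over all duplicate-free words instead of permutations of an interval, so that
    the notion passes to the factors s(L) and s(R). *)
Definition unique_preimage (w : seq nat) : Prop :=
  sortable w /\ forall v1 v2, uniq v1 -> uniq v2 ->
    stack_sort v1 = w -> stack_sort v2 = w -> v1 = v2.

Lemma sortable_nil : sortable [::].
Proof. by exists [::]. Qed.

Lemma sortable_uniq (w : seq nat) : sortable w -> uniq w.
Proof. by case=> v uv <-; rewrite (perm_uniq (stack_sort_perm uv)). Qed.

Lemma stack_sort_rcons (v u : seq nat) (m : nat) :
  uniq v -> stack_sort v = rcons u m ->
  exists L R, [/\ v = L ++ m :: R, uniq L, uniq R, all (fun x => x < m) u
                & u = stack_sort L ++ stack_sort R].
Proof.
move=> uv; have [-> /(congr1 size)|] := eqVneq v [::].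
  by rewrite size_rcons.
case/(max_split uv)=> L [n [R [ev ltL ltR]]].
move: uv; rewrite ev cat_uniq /= => /and3P[uL _ /andP[_ uR]].
rewrite stack_sort_cat // catA cats1 => /rcons_inj[eu en].
exists L, R; split; rewrite -?en //.
by rewrite -eu all_cat !(perm_all _ (stack_sort_perm _)) // ltL.
Qed.

Lemma stack_sort_join (L R : seq nat) (m : nat) :
  let u := stack_sort L ++ stack_sort R in
  uniq L -> uniq R -> uniq u -> all (fun x => x < m) u ->
  uniq (L ++ m :: R) /\ stack_sort (L ++ m :: R) = rcons u m.
Proof.
move=> /= uL uR uLR ltm.
have pLR : perm_eq (stack_sort L ++ stack_sort R) (L ++ R).
  by apply: perm_cat; apply: stack_sort_perm.
split.
  rewrite -cat1s uniq_catCA /= -(perm_uniq pLR) uLR andbT -(perm_mem pLR).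
  by apply/negP => /(allP ltm); rewrite ltnn.
move: ltm; rewrite (perm_all _ pLR) all_cat => /andP[ltL ltR].
by rewrite stack_sort_cat // catA cats1.
Qed.

Lemma sortable_rcons (u : seq nat) (m : nat) : sortable (rcons u m) ->
  all (fun x => x < m) u /\
  exists A B, [/\ u = A ++ B, sortable A & sortable B].
Proof.
case=> v uv /(stack_sort_rcons uv)[L [R [_ uL uR ltm eu]]].
by split=> //; exists (stack_sort L), (stack_sort R); split=> //;
  [exists L | exists R].
Qed.

Lemma sortable_join (A B : seq nat) (m : nat) :
  sortable A -> sortable B -> uniq (A ++ B) ->
  all (fun x => x < m) (A ++ B) -> sortable (rcons (A ++ B) m).
Proof.
case=> L uL <- [R uR <-] uAB ltm.
by have [u e] := stack_sort_join uL uR uAB ltm; exists (L ++ m :: R).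
Qed.

Lemma sortable_last (x : nat) (w : seq nat) :
  sortable w -> x \in w -> x <= last 0 w.
Proof.
case/lastP: w => // u m /sortable_rcons[/allP ltm _].
by rewrite mem_rcons inE last_rcons => /predU1P[->//|/ltm/ltnW].
Qed.

Lemma sortable_seq1 (m : nat) : sortable [:: m].
Proof. by apply: (@sortable_join [::] [::] m) => //; apply: sortable_nil. Qed.

(** * Descents of sortable words *)

Fixpoint descents (w : seq nat) : nat :=
  if w is x :: t then (head x t < x) + descents t else 0.

(** The defaults make the junction term vanish when a word is empty: an empty [s] has last letter 0,
    and an empty [t] makes [last 0 s] be compared with itself. *)
Lemma descents_cat (s t : seq nat) :
  descents (s ++ t) =
  descents s + (head (last 0 s) t < last 0 s) + descents t.
Proof.
elim: s => [|x [|y s] IH] /=; first by case: t => [|y t] /=; rewrite ?ltn0.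
- by case: t {IH}; rewrite /= ltnn.
by rewrite /= in IH; rewrite IH !addnA.
Qed.

Lemma descents_rcons (u : seq nat) (m : nat) :
  all (fun x => x < m) u -> descents (rcons u m) = descents u.
Proof.
move=> ltm; rewrite -cats1 descents_cat /= ltnn !addn0.
case/lastP: u ltm => [|u y]; rewrite ?all_rcons ?last_rcons /=; lia.
Qed.

(* Every descent from the last letter of [s] on claims a letter of [t] that is
   not a descent bottom, namely the point where its hook ends. *)
Lemma sortable_descents (s t : seq nat) : sortable (s ++ t) -> t != [::] ->
  2 * descents t + 1 + (head 0 t < last 0 s) <= size t.
Proof.
have [n] := ubnP (size (s ++ t)); elim: n s t => // n IH s t.
case/lastP: t => // t m; rewrite -rcons_cat size_rcons ltnS => sn.
case/sortable_rcons=> ltm [A [B [eAB sA sB]]] _.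
have sAB : size A + size B < n by rewrite -size_cat -eAB.
have ltt : all (fun x => x < m) t by move: ltm; rewrite all_cat => /andP[].
rewrite descents_rcons // size_rcons.
have [t0|t0] := eqVneq t [::].
  rewrite t0 /=; suff -> : (m < last 0 s) = false by [].
  apply/negbTE; rewrite -leqNgt; move: ltm; rewrite all_cat => /andP[+ _].
  by case/lastP: (s) => // s' y; rewrite last_rcons all_rcons => /andP[/ltnW].
have -> : head 0 (rcons t m) = head 0 t by case: (t) t0.
(* With the empty prefix the last letter defaults to 0, so no descent enters [B]. *)
have IHB : B != [::] -> 2 * descents B + 1 <= size B.
  by move=> B0; have := IH [::] B; rewrite cat0s ltn0 addn0; apply=> //; lia.
(* The cut between [A] and [B] falls inside [t] or inside [s]. In the first case a descent from [C]
   to [B] costs two, paid by the extra unit of one factor and by the letter [m]. *)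
case: (cat_eq_cat eAB) => [[C eA et]|[C es eB]].
  have [C0|C0] := eqVneq C [::].
    by move: IHB; rewrite et C0 /= in t0 *; move=> /(_ t0); lia.
  have hC : head 0 t = head 0 C by rewrite et; case: (C) C0.
  have IHA : 2 * descents C + 1 + (head 0 C < last 0 s) <= size C.
    by apply: IH; rewrite -?eA //; lia.
  rewrite et in hC *; rewrite hC descents_cat size_cat.
  have [B0|B0] := eqVneq B [::]; last by move: (IHB B0); lia.
  by rewrite B0 /= ltnn; lia.
have IHt : 2 * descents t + 1 + (head 0 t < last 0 C) <= size t.
  by apply: IH; rewrite -?eB //; lia.
(* If [C] is empty, the bound for [B] does not see a descent into [t]; the letter [m] pays for
   it. *)
by case/lastP: C es eB IHt => [|C y]; rewrite ?es -?rcons_cat ?last_rcons; lia.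
Qed.

(** The last letter of [B] is maximal in [B], and by the ascent at the junction in [A] too. It can
    therefore close the whole word, with [A] absorbed into the first nonempty factor of [B] by
    induction. *)
Lemma sortable_cat (A B : seq nat) : sortable A -> sortable B ->
  uniq (A ++ B) -> (B != [::] -> last 0 A < head 0 B) -> sortable (A ++ B).
Proof.
have [n] := ubnP (size B); elim: n A B => // n IH A B.
case/lastP: B => [|B m]; first by rewrite cats0.
rewrite size_rcons ltnS => sn sA sBm; rewrite -rcons_cat rcons_uniq.
have [ltB [B1 [B2 [eB sB1 sB2]]]] := sortable_rcons sBm.
case/andP=> _ uAB; have -> : rcons B m != [::] by case: (B).
move=> /(_ isT) ltA.
have hm : head 0 (rcons B m) <= m.
  by case: (B) ltB => //= x u /andP[/ltnW].
have ltAB : all (fun x => x < m) (A ++ B).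
  rewrite all_cat ltB andbT; apply/allP => x /(sortable_last sA) xA.
  exact: leq_ltn_trans xA (leq_trans ltA hm).
have [B10|B10] := eqVneq B1 [::].
  have e : B = B2 by rewrite eB B10.
  have [B20|B20] := eqVneq B [::].
    by move: uAB ltAB; rewrite B20 => *; apply: sortable_join => //;
       exact: sortable_nil.
  rewrite -[A ++ B]cats0; apply: sortable_join; rewrite ?cats0 //.
    have sB : sortable B by rewrite e.
    by apply: IH => // _; case: (B) B20 ltA.
  exact: sortable_nil.
rewrite eB catA in uAB ltAB *; apply: sortable_join => //.
apply: IH => //.
- by move: sn; rewrite eB size_cat; lia.
- by move: uAB; rewrite cat_uniq => /andP[].
- by move=> _; move: ltA; rewrite eB; case: (B1) B10.
Qed.

(** Postorder readings of decreasing full binary trees, each node showing a descent where its left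
    subtree ends. The map s turns the inorder reading of a decreasing tree into its postorder
    reading. *)
Inductive tree_word : seq nat -> Prop :=
| TreeLeaf m : tree_word [:: m]
| TreeNode A B m : tree_word A -> tree_word B -> head 0 B < last 0 A ->
    all (fun x => x < m) (A ++ B) -> tree_word (rcons (A ++ B) m).

Lemma tree_word_neq0 (w : seq nat) : tree_word w -> w != [::].
Proof. by case=> [m|A B m _ _ _ _]; rewrite -size_eq0 ?size_rcons. Qed.

Lemma tree_word_sortable (w : seq nat) :
  tree_word w -> uniq w -> sortable w.
Proof.
elim=> [m _|A B m _ IHA _ IHB _ ltm]; first exact: sortable_seq1.
rewrite rcons_uniq => /andP[_ uAB]; have := uAB.
rewrite cat_uniq => /and3P[/IHA sA _ /IHB sB].
exact: sortable_join.
Qed.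

(** The equality case of [sortable_descents] for an empty prefix: each node adds exactly one
    descent, at its junction. *)
Lemma tree_word_size (w : seq nat) :
  tree_word w -> size w = 2 * descents w + 1.
Proof.
elim=> [m|A B m _ IHA GB IHB ltBA ltm]; first by rewrite /= ltnn.
rewrite descents_rcons // size_rcons size_cat descents_cat.
have -> : head (last 0 A) B = head 0 B by case: (B) (tree_word_neq0 GB).
by rewrite ltBA IHA IHB; lia.
Qed.

(** Any freedom in cutting [u] into two images would give a second preimage. This excludes an empty
    side and an ascent at the junction, and makes both factors uniquely sorted. *)
Lemma unique_preimage_tree (w : seq nat) :
  w != [::] -> unique_preimage w -> tree_word w.
Proof.
have [n] := ubnP (size w); elim: n w => // n IH w.
case/lastP: w => // u m; rewrite size_rcons ltnS => sn _ [[v uv sv] uniqv].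
have uum : uniq (rcons u m) by apply: sortable_uniq; exists v.
have [L [R [ev uL uR ltm eu]]] := stack_sort_rcons uv sv.
have uu : uniq u by move: uum; rewrite rcons_uniq => /andP[].
have other L' R' : uniq L' -> uniq R' ->
    stack_sort L' ++ stack_sort R' = u -> L' = L /\ R' = R.
  move=> uL' uR' eu'; rewrite -eu' in uu ltm uniqv.
  have [u' s'] := stack_sort_join uL' uR' uu ltm.
  have := uniqv _ _ uv u'; rewrite sv eu' s' eu' => /(_ erefl erefl).
  rewrite ev => e.
  have nm X Y : uniq (X ++ m :: Y) -> m \notin X.
    by rewrite cat_uniq /= negb_or => /and3P[_ /andP[]].
  by case/cat_cons_inj: e; [apply: (nm _ R); rewrite -ev | apply: nm u' |].
have [u0|u0] := eqVneq u [::]; first by rewrite u0; exact: TreeLeaf.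
have sLE : size (stack_sort L) = size L := perm_size (stack_sort_perm uL).
have sRE : size (stack_sort R) = size R := perm_size (stack_sort_perm uR).
have su : size u = size L + size R by rewrite eu size_cat sLE sRE.
(* With one side empty, exchanging [L] and [R] leaves [u] unchanged, so uniqueness makes both
   empty. *)
have L0 : L != [::].
  apply: contraNneq u0 => L0; have [] := other R L uR uL.
    by rewrite eu L0 cats0.
  by move=> eR _; rewrite eu L0 eR L0.
have R0 : R != [::].
  apply: contraNneq u0 => R0; have [] := other R L uR uL.
    by rewrite eu R0 cats0.
  by move=> eL _; rewrite eu -eL R0.
have ne X : uniq X -> X != [::] -> stack_sort X != [::].
  by move=> uX; rewrite -!size_eq0 (perm_size (stack_sort_perm uX)).
rewrite eu; move: (L0) (R0); rewrite -!size_eq0 => szL szR.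
have GL : tree_word (stack_sort L).
  apply: IH; rewrite ?ne ?sLE //; first by lia.
  have max X : uniq X -> stack_sort X = stack_sort L -> X = L.
    by move=> uX eX; case: (other X R); rewrite ?eX.
  by split; [exists L | move=> v1 v2 u1 u2 /(max _ u1)-> /(max _ u2)->].
have GR : tree_word (stack_sort R).
  apply: IH; rewrite ?ne ?sRE //; first by lia.
  have max X : uniq X -> stack_sort X = stack_sort R -> X = R.
    by move=> uX eX; case: (other L X); rewrite ?eX.
  by split; [exists R | move=> v1 v2 u1 u2 /(max _ u1)-> /(max _ u2)->].
apply: TreeNode; rewrite -?eu // ltnNge leq_eqVlt.
apply/negP => /predU1P[e|lt].
  have := uu; rewrite eu cat_uniq
    => /and3P[_ /hasPn/(_ (head 0 (stack_sort R)))].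
  case: (stack_sort R) (ne R uR R0) e => //= x R1 _ <- /(_ (mem_head _ _)).
  by case/lastP: (stack_sort L) (ne L uL L0) => // L1 y _;
    rewrite last_rcons mem_rcons mem_head.
(* After an ascent, [u] as a whole would be sortable, giving a second preimage with nothing to the
   right of [m]. *)
have [||||v' uv' sv'] := @sortable_cat (stack_sort L) (stack_sort R).
- by exists L.
- by exists R.
- by rewrite -eu.
- by [].
have [||_] := other v' [::] uv'; rewrite ?cats0 // ?sv' -?eu //.
by move=> e; rewrite -e in R0.
Qed.

(** [A] and [B] meet the descent bound with equality. A cut further right puts the junction descent
    inside [A'], a cut further left puts it inside [B']; either way the bounds exceed the available
    length. *)
Lemma tree_split (A B A' B' : seq nat) :
  tree_word A -> tree_word B -> head 0 B < last 0 A ->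
  sortable A' -> sortable B' -> uniq (A ++ B) -> A ++ B = A' ++ B' ->
  A = A' /\ B = B'.
Proof.
move=> GA GB ltBA sA' sB' uAB e.
have szA := tree_word_size GA; have szB := tree_word_size GB.
have hB x : head x B = head 0 B by case: (B) (tree_word_neq0 GB).
case: (cat_eq_cat e) => [[C eA' eB]|[C eA eB']].
  have [C0|C0] := eqVneq C [::]; first by rewrite eA' eB C0 cats0.
  have hC x : head x C = head 0 B by rewrite eB; case: (C) C0.
  have := @sortable_descents [::] A'; rewrite cat0s ltn0 addn0 => /(_ sA').
  have -> : A' != [::] by rewrite eA'; case: (A) (tree_word_neq0 GA).
  move=> /(_ isT); rewrite eA' size_cat descents_cat hC ltBA.
  have [B'0|B'0] := eqVneq B' [::].
    by rewrite B'0 cats0 in eB; rewrite -eB; lia.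
  (* [B] is sortable as a whole, so the bound for its suffix [B'] also counts a descent from [C]
     into [B']. *)
  have sB : sortable (C ++ B').
    rewrite -eB; apply: tree_word_sortable => //.
    by move: uAB; rewrite cat_uniq => /and3P[].
  have := sortable_descents sB B'0.
  move: szB; rewrite eB size_cat descents_cat.
  have -> : head (last 0 C) B' = head 0 B' by case: (B') B'0.
  lia.
have [C0|C0] := eqVneq C [::]; first by rewrite eA eB' C0 cats0.
rewrite eB' in sB'; have := sortable_descents sB' (tree_word_neq0 GB).
move: ltBA; rewrite eA last_cat; case/lastP: (C) C0 => // C' y _.
by rewrite !last_rcons => ->; lia.
Qed.

Lemma tree_unique_preimage (w : seq nat) :
  tree_word w -> uniq w -> unique_preimage w.
Proof.
elim=> [m _|A B m GA IHA GB IHB ltBA ltm uw].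
  split; first exact: sortable_seq1.
  have one v : uniq v -> stack_sort v = rcons [::] m -> v = [:: m].
    move=> uv /(stack_sort_rcons uv)[L [R [-> uL uR _]]].
    move=> /(congr1 size); rewrite size_cat.
    rewrite !(perm_size (stack_sort_perm _)) //.
    by case: L {uL}; case: R {uR}.
  by move=> v1 v2 u1 u2 /(one _ u1)-> /(one _ u2)->.
split; first exact: tree_word_sortable (TreeNode GA GB ltBA ltm) uw.
have uAB : uniq (A ++ B) by move: uw; rewrite rcons_uniq => /andP[].
move=> v1 v2 u1 u2 /(stack_sort_rcons u1)[L1 [R1 [-> uL1 uR1 _ e1]]].
move=> /(stack_sort_rcons u2)[L2 [R2 [-> uL2 uR2 _ e2]]].
have sortableE v : uniq v -> sortable (stack_sort v) by exists v.
have [eA1 eB1] := tree_split GA GB ltBA (sortableE _ uL1) (sortableE _ uR1)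
  uAB e1.
have [eA2 eB2] := tree_split GA GB ltBA (sortableE _ uL2) (sortableE _ uR2)
  uAB e2.
move: uAB; rewrite cat_uniq => /and3P[uA _ uB].
by rewrite ((IHA uA).2 L1 L2) // ((IHB uB).2 R1 R2).
Qed.

(** * Pattern avoidance *)

Definition no132 (w : seq nat) : Prop :=
  forall x y z, subseq [:: x; y; z] w -> ~~ (x < z < y).

Definition no231 (w : seq nat) : Prop :=
  forall x y z, subseq [:: x; y; z] w -> ~~ (z < x < y).

Definition no3421 (w : seq nat) : Prop :=
  forall x y z t, subseq [:: x; y; z; t] w -> ~~ [&& t < z, z < x & x < y].

Lemma contains132 (w : seq nat) : ~~ contains w [:: 1; 3; 2] <-> no132 w.
Proof.
split=> [nc x y z sw|no].
  apply: contra nc => lt; apply/containsP; exists [:: x; y; z] => //.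
  apply/andP; split=> //; apply/forallP => -[i /= lti];
    apply/forallP => -[j /= ltj].
  by case: i lti => [|[|[|i]]] //= _; case: j ltj => [|[|[|j]]] //= _; lia.
apply/containsP => -[[|x [|y [|z [|? ?]]]] // sw /andP[_ /forallP iso]].
have iso' i j (lti : i < 3) (ltj : j < 3) :=
  forallP (iso (Ordinal lti)) (Ordinal ltj).
have := no _ _ _ sw.
have := iso' 0 2 isT isT; have := iso' 2 1 isT isT => /=; lia.
Qed.

Lemma contains3421 (w : seq nat) : ~~ contains w [:: 3; 4; 2; 1] <-> no3421 w.
Proof.
split=> [nc x y z t sw|no].
  apply: contra nc => lt; apply/containsP; exists [:: x; y; z; t] => //.
  apply/andP; split=> //; apply/forallP => -[i /= lti];
    apply/forallP => -[j /= ltj].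
  by case: i lti => [|[|[|[|i]]]] //= _; case: j ltj => [|[|[|[|j]]]] //= _;
    lia.
apply/containsP => -[[|x [|y [|z [|t [|? ?]]]]] // sw /andP[_ /forallP iso]].
have iso' i j (lti : i < 4) (ltj : j < 4) :=
  forallP (iso (Ordinal lti)) (Ordinal ltj).
have := no _ _ _ _ sw.
have := iso' 0 1 isT isT; have := iso' 2 0 isT isT; have := iso' 3 2 isT isT.
by move=> /=; lia.
Qed.

Lemma avoidsE (w : seq nat) :
  avoids w [:: [:: 1; 3; 2]; [:: 3; 4; 2; 1]] <-> no132 w /\ no3421 w.
Proof.
rewrite /avoids /= andbT; split=> [/andP[/contains132 ? /contains3421 //]|].
by case=> /contains132 -> /contains3421 ->.
Qed.

Lemma no132_sub (u w : seq nat) : subseq u w -> no132 w -> no132 u.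
Proof. by move=> s no x y z sx; apply/no/(subseq_trans sx). Qed.

Lemma no231_sub (u w : seq nat) : subseq u w -> no231 w -> no231 u.
Proof. by move=> s no x y z sx; apply/no/(subseq_trans sx). Qed.

Lemma no3421_sub (u w : seq nat) : subseq u w -> no3421 w -> no3421 u.
Proof. by move=> s no x y z t sx; apply/no/(subseq_trans sx). Qed.

Lemma subseq_rcons2 (s w : seq nat) (a m : nat) :
  subseq (rcons s a) (rcons w m) =
  if a == m then subseq s w else subseq (rcons s a) w.
Proof.
rewrite -subseq_rev !rev_rcons /=.
by case: eqP => // _; rewrite -?rev_rcons subseq_rev.
Qed.

(* Decreasing down to its minimum, then increasing, built by adding at once a
   new first and a new last letter. *)
Inductive vee : seq nat -> Prop :=
| VeeLeaf c : vee [:: c]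
| VeeWrap d w m : vee w -> head 0 w < d -> all (fun x => x < m) (d :: w) ->
    vee (d :: rcons w m).

(** The notch is [b], lying below the vee before it; in a permutation it is the letter 1. The [m] of
    the first constructor is the letter called g in the overall shape. *)
Inductive notched : seq nat -> Prop :=
| NotchedVee A b m : vee A -> all (fun x => b < x) A ->
    all (fun x => x < m) (rcons A b) -> notched (rcons (rcons A b) m)
| NotchedWrap d w m : notched w -> head 0 w < d ->
    all (fun x => x < m) (d :: w) -> notched (d :: rcons w m).

(** * Avoidance under wrapping *)

Lemma tree_wrap (d m : nat) (w : seq nat) : tree_word w -> head 0 w < d ->
  all (fun x => x < m) (d :: w) -> tree_word (d :: rcons w m).
Proof. by move=> Gw hd ltm; apply: (TreeNode (TreeLeaf d) Gw). Qed.

Lemma vee_tree (w : seq nat) : vee w -> tree_word w.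
Proof.
by elim=> [c|d u m _ Gu hd ltm]; [exact: TreeLeaf | exact: tree_wrap].
Qed.

Lemma notched_tree (w : seq nat) : notched w -> tree_word w.
Proof.
elim=> [A b m /vee_tree GA ltb ltm|d u m _ Gu hd ltm]; last exact: tree_wrap.
rewrite -cats1 in ltm *; apply: TreeNode => //; first exact: TreeLeaf.
case/lastP: A {ltm} GA ltb => [/tree_word_neq0 //|A a _].
by rewrite last_rcons all_rcons => /andP[].
Qed.

(** The patterns 132, 231 and 3421 all end below an earlier letter, so a maximal last letter [m]
    never takes part in them. *)
Lemma subseq_unwrap (s w : seq nat) (d m y z : nat) :
  all (fun x => x < m) (d :: w) -> subseq (rcons s z) (d :: rcons w m) ->
  y \in s -> z < y -> subseq (rcons s z) (d :: w).
Proof.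
move=> ltm; rewrite -rcons_cons subseq_rcons2; case: eqP => // -> sw ys lt.
by have := allP ltm y (mem_subseq sw ys); lia.
Qed.

(** In an occurrence starting at [d], the smaller letter [h] heading [w] cannot be the second
    letter, and can replace [d]. *)
Lemma no132_wrap (d m : nat) (w : seq nat) : no132 w -> head 0 w < d ->
  all (fun x => x < m) (d :: w) -> no132 (d :: rcons w m).
Proof.
move=> no hd ltm x y z s; apply/negP => lt.
have {s} : subseq [:: x; y; z] (d :: w).
  by apply: (@subseq_unwrap [:: x; y] w d m y z ltm s);
    rewrite ?inE ?eqxx ?orbT; lia.
case: w no hd {ltm} => [_ _ /size_subseq //|h w] no /= hd.
case: (eqVneq x d) => [xd|_ s]; last by move: (no x y z s); lia.
case: (eqVneq y h) => [yh|yh s]; first by lia.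
by have := no h y z; rewrite /= eqxx s => /(_ isT); lia.
Qed.

(** When [h] replaces [d], the result is a 231 if [z < h] and a 132 if [h < z], both excluded from
    [w]. The same dichotomy settles 3421 below. *)
Lemma no231_wrap (d m : nat) (w : seq nat) : no132 w -> no231 w -> uniq w ->
  head 0 w < d -> all (fun x => x < m) (d :: w) -> no231 (d :: rcons w m).
Proof.
move=> no1 no uw hd ltm x y z s; apply/negP => lt.
have {s} : subseq [:: x; y; z] (d :: w).
  by apply: (@subseq_unwrap [:: x; y] w d m y z ltm s);
    rewrite ?inE ?eqxx ?orbT; lia.
case: w no1 no uw hd {ltm} => [_ _ _ _ /size_subseq //|h w] no1 no uw /= hd.
case: (eqVneq x d) => [xd|_ s]; last by move: (no x y z s); lia.
case: (eqVneq y h) => [yh|yh s]; first by lia.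
have zw : z \in w by apply: (mem_subseq s); rewrite !inE eqxx orbT.
have zh : z != h by apply: contraTneq zw => ->; case/andP: uw.
have := no1 h y z; have := no h y z.
by rewrite /= eqxx s => /(_ isT) + /(_ isT); lia.
Qed.

Lemma no3421_wrap (d m : nat) (w : seq nat) : no132 w -> no3421 w -> uniq w ->
  head 0 w < d -> all (fun x => x < m) (d :: w) -> no3421 (d :: rcons w m).
Proof.
move=> no1 no uw hd ltm x y z t s; apply/negP => lt.
have {s} : subseq [:: x; y; z; t] (d :: w).
  by apply: (@subseq_unwrap [:: x; y; z] w d m y t ltm s);
    rewrite ?inE ?eqxx ?orbT; lia.
case: w no1 no uw hd {ltm} => [_ _ _ _ /size_subseq //|h w] no1 no uw /= hd.
case: (eqVneq x d) => [xd|_ s]; last by move: (no x y z t s); lia.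
case: (eqVneq y h) => [yh|yh s]; first by lia.
have zw : z \in w by apply: (mem_subseq s); rewrite !inE eqxx orbT.
have zh : z != h by apply: contraTneq zw => ->; case/andP: uw.
have s' : subseq [:: y; z] w.
  by apply: subseq_trans s; apply: (prefix_subseq [:: y; z] [:: t]).
have := no1 h y z; have := no h y z t.
by rewrite /= eqxx s s' => /(_ isT) + /(_ isT); lia.
Qed.

Lemma vee_avoids (w : seq nat) : vee w -> uniq w -> no132 w /\ no231 w.
Proof.
elim=> [c _|d u m _ IH hd ltm] /=.
  by split=> x y z /size_subseq.
rewrite mem_rcons rcons_uniq => /and3P[_ _ uu]; have [no1 no2] := IH uu.
by split; [exact: no132_wrap | exact: no231_wrap].
Qed.

Lemma notched_avoids (w : seq nat) :
  notched w -> uniq w -> no132 w /\ no3421 w.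
Proof.
elim=> [A b m vA ltb ltm|d u m _ IH hd ltm] /=; last first.
  rewrite mem_rcons rcons_uniq => /and3P[_ _ uu]; have [no1 no2] := IH uu.
  by split; [exact: no132_wrap | exact: no3421_wrap].
rewrite !rcons_uniq => /and3P[_ _ /(vee_avoids vA)[no1 no2]].
split=> [x y z s|x y z t s]; apply/negP => lt.
  move: s; rewrite -[[:: x; y; z]]/(rcons [:: x; y] z) !subseq_rcons2.
  case: eqP => [e s|_].
    by have := allP ltm y (mem_subseq s _);
      rewrite !inE eqxx orbT => /(_ isT); lia.
  case: eqP => [e s|_ s]; last by have := no1 x y z s; lia.
  by have := allP ltb x (mem_subseq s _); rewrite !inE eqxx => /(_ isT); lia.
(* The first three letters of a 3421 form a 231, which the vee [A] avoids. *)
move: s; rewrite -[[:: x; y; z; t]]/(rcons [:: x; y; z] t) !subseq_rcons2.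
case: eqP => [e s|_].
  by have := allP ltm y (mem_subseq s _); rewrite !inE eqxx orbT => /(_ isT);
    lia.
case: eqP => [e s|_ s]; first by have := no2 x y z s; lia.
have := no2 x y z; rewrite (subseq_trans _ s) => [/(_ isT)|]; first by lia.
exact: (prefix_subseq [:: x; y; z] [:: t]).
Qed.

(** * Shape of the avoiding tree words *)

Lemma tree_shape (w : seq nat) : tree_word w ->
  (exists x, w = [:: x]) \/
  exists x u a, w = x :: rcons u a /\ x < a.
Proof.
case=> [m|A B m GA _ _ ltm]; first by left; exists m.
right; case: A GA ltm => [/tree_word_neq0 //|x A] _ /= /andP[ltx _].
by exists x, (A ++ B), m; rewrite rcons_cat.
Qed.

Lemma subseq_ends (x a b m : nat) (u B : seq nat) (s : seq nat) :
  subseq s B ->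
  subseq [:: x, a, b & s] (rcons ((x :: rcons u a) ++ b :: B) m).
Proof.
move=> sB; rewrite rcons_cat /= eqxx.
apply: (@cat_subseq _ [:: a] [:: b & s]);
  first by rewrite sub1seq mem_rcons mem_head.
by rewrite /= eqxx; apply: subseq_trans sB _; exact: subseq_rcons.
Qed.

(** The left subtree must be a leaf: otherwise its end letters [x < a] and the next letter [b < a]
    form a 132 or a 231. So every node is a wrap. *)
Lemma tree_vee (w : seq nat) :
  tree_word w -> uniq w -> no132 w -> no231 w -> vee w.
Proof.
elim=> [m *|A B m GA IHA GB IHB ltBA ltm uw no1 no2]; first exact: VeeLeaf.
have uAB : uniq (A ++ B) by move: uw; rewrite rcons_uniq => /andP[].
have [uA uB] : uniq A /\ uniq B by move: uAB; rewrite cat_uniq => /and3P[].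
have sB : subseq B (rcons (A ++ B) m).
  rewrite rcons_cat; apply: subseq_trans (suffix_subseq _ _).
  exact: subseq_rcons.
case: (tree_shape GA) => [[x eA]|[x [u [a [eA xa]]]]].
  rewrite eA /= in ltBA ltm *; apply: VeeWrap => //.
  exact: IHB uB (no132_sub sB no1) (no231_sub sB no2).
case: B GB ltBA uAB {IHB ltm uB uw sB} no1 no2 => [/tree_word_neq0 //|b B] _.
rewrite eA /= last_rcons => ltba uAB no1 no2.
have s := subseq_ends x a b m u (sub0seq B).
have xb : x != b.
  by apply: contraTneq uAB => ->; rewrite /= mem_cat mem_head orbT.
by have := no1 _ _ _ s; have := no2 _ _ _ s; lia.
Qed.

(** A leaf on the left gives a wrap, or the smallest notched word when the right side is a leaf too.
    A larger left subtree must be a vee, and the right one a single lower letter, the notch. *)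
Lemma tree_notched (w : seq nat) : tree_word w -> uniq w ->
  no132 w -> no3421 w -> notched w \/ exists m, w = [:: m].
Proof.
elim=> [m *|A B m GA IHA GB IHB ltBA ltm uw no1 no2]; first by right; exists m.
left.
have uAB : uniq (A ++ B) by move: uw; rewrite rcons_uniq => /andP[].
have [uA uB] : uniq A /\ uniq B by move: uAB; rewrite cat_uniq => /and3P[].
have sB : subseq B (rcons (A ++ B) m).
  rewrite rcons_cat; apply: subseq_trans (suffix_subseq _ _).
  exact: subseq_rcons.
have sA : subseq A (rcons (A ++ B) m).
  by rewrite rcons_cat; exact: prefix_subseq.
case: (tree_shape GA) => [[x eA]|[x [u [a [eA xa]]]]].
  rewrite eA /= in ltBA ltm *.
  case: (IHB uB (no132_sub sB no1) (no3421_sub sB no2)) => [WB|[b eB]].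
    exact: NotchedWrap.
  rewrite eB /= in ltBA ltm *; apply: (@NotchedVee [:: x]) => //=.
    exact: VeeLeaf.
  by rewrite ltBA.
case: B GB ltBA uAB {IHB} ltm uB uw sA sB no1 no2 => [/tree_word_neq0 //|b B].
move=> GB ltBA uAB ltm uB uw sA sB no1 no2.
have ltba : b < a by move: ltBA; rewrite eA /= last_rcons.
have nb v : v \in A -> v != b.
  move=> vA; apply: contraTneq uAB => vb.
  by rewrite cat_uniq /= -vb vA /= andbF.
(* A letter [v] of [A] below [b] would form a 132 with [a] and [b]. *)
have ltb : all (fun v => b < v) A.
  apply/allP => v vA; have := nb v vA; move: (vA); rewrite eA.
  rewrite -rcons_cons mem_rcons inE => /predU1P[-> //|vu] vb.
  have := no1 v a b; rewrite eA rcons_cat -rcons_cons cat_rcons.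
  have -> : subseq [:: v; a; b] ((x :: u) ++ a :: rcons (b :: B) m).
    apply: (@cat_subseq _ [:: v] [:: a; b]); first by rewrite sub1seq.
    by rewrite /= !eqxx sub0seq.
  by move=> /(_ isT); lia.
suff eB : B = [::].
  rewrite eB cats1 in uw ltm no1 no2 sA *; apply: NotchedVee => //.
  apply: tree_vee => //; first exact: no132_sub no1.
  (* A 231 in [A] followed by the lower letter [b] would be a 3421. *)
  move=> p q r s; apply/negP => lt; have := no2 p q r b.
  rewrite -cats1 -cats1 -catA.
  rewrite (@cat_subseq _ [:: p; q; r] [:: b]) //= ?eqxx // => /(_ isT).
  by have := allP ltb r (mem_subseq s _); rewrite !inE eqxx !orbT => /(_ isT);
    lia.
(* If the right subtree is not a leaf, its own right subtree starts with some [q]. Avoiding 132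
   forces [q < b], and then [x], [a], [b], [q] form a 3421. *)
case eGB: {2}(b :: B) / GB => [n|A1 B1 n GA1 GB1 lt1 _]; first by case: eGB.
case: B1 GB1 lt1 eGB => [/tree_word_neq0 //|q B1] _ /=.
case: A1 GA1 => [/tree_word_neq0 //|y A1] _ /= ltq [yb eB].
rewrite -yb {y yb} in ltq.
have qB : q \in B by rewrite eB mem_rcons inE mem_cat mem_head !orbT.
have qb : q != b by apply: contraTneq uB => <-; rewrite /= qB.
have ltqb : q < b.
  case/lastP: A1 ltq eB => [//|A1 p]; rewrite last_rcons => ltq eB.
  have no1B : no132 (b :: B) := no132_sub sB no1.
  have := no1B b p q.
  rewrite /= eqxx eB rcons_cat (@cat_subseq _ [:: p] [:: q]).
  - by move=> /(_ isT); lia.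
  - by rewrite sub1seq mem_rcons mem_head.
  - by rewrite sub1seq mem_rcons !inE eqxx orbT.
have := no2 x a b q; rewrite eA subseq_ends ?sub1seq // => /(_ isT).
by have := allP ltb x; rewrite eA mem_head => /(_ isT); lia.
Qed.

(** * Dominated pairs of sequences *)

(* For increasing sequences of equal length: the i-th entry of [es] is smaller
   than the i-th entry of [us]. *)
Definition dominated (es us : seq nat) : Prop :=
  forall v, count (leq v) es <= count (ltn v) us.

Lemma dominated_rcons (es us : seq nat) (d m : nat) :
  all (fun x => x < d) es -> all (fun x => x < m) us ->
  dominated (rcons es d) (rcons us m) <-> d < m /\ dominated es us.
Proof.
move=> ltd ltm.
have es0 v : d <= v -> count (leq v) es = 0.
  move=> dv; apply/eqP; rewrite -leqn0 leqNgt -has_count; apply/hasPn => x.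
  by move/(allP ltd); rewrite /=; lia.
have us0 v : m <= v -> count (ltn v) us = 0.
  move=> dv; apply/eqP; rewrite -leqn0 leqNgt -has_count; apply/hasPn => x.
  by move/(allP ltm); rewrite /=; lia.
split=> [dom|[dm dom] v].
  have dm : d < m.
    (* At threshold [d] the left count is positive, so some upper entry exceeds [d]; [m] bounds the
       others, hence [d < m]. *)
    have := dom d; rewrite -!cats1 !count_cat /= leqnn.
    by case: ltnP => // md; rewrite us0 //; lia.
  split=> // v; have := dom v; rewrite -!cats1 !count_cat /=.
  by case: (leqP v d) => vd; [lia | rewrite (es0 v (ltnW vd))].
have := dom v; rewrite -!cats1 !count_cat /=.
by case: (leqP v d) => vd; [lia | rewrite (es0 v (ltnW vd))].
Qed.

Lemma pairwise_rcons_ltn (s : seq nat) (m : nat) :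
  pairwise ltn (rcons s m) = all (fun x => x < m) s && pairwise ltn s.
Proof. by rewrite -cats1 pairwise_cat /= allrel1r andbT. Qed.

(** * Explicit form of vees and notched words *)

Lemma vee_form (w : seq nat) : vee w -> exists c es us,
  [/\ w = rev es ++ c :: us, pairwise ltn (c :: es), pairwise ltn (c :: us),
      size es = size us & dominated es us].
Proof.
elim=> [c|d u m _ [c [es [us [-> ces cus szE dom]]]] hd ltm].
  by exists c, [::], [::].
have ltd : all (fun x => x < d) (c :: es).
  case/lastP: es ces hd {szE dom ltm} => [|es e] /=; first by move=> _ ->.
  rewrite rev_rcons /= pairwise_rcons_ltn all_rcons.
  move=> /andP[/andP[ce _] /andP[lte _]] ed.
  rewrite all_rcons ed (ltn_trans ce) //=.
  by apply: sub_all lte => x /ltn_trans; apply.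
have [dm ltcus] : d < m /\ all (fun x => x < m) (c :: us).
  by move: ltm; rewrite /= all_cat => /and3P[].
exists c, (rcons es d), (rcons us m); split.
- by rewrite rev_rcons rcons_cat.
- by rewrite -rcons_cons pairwise_rcons_ltn ltd.
- by rewrite -rcons_cons pairwise_rcons_ltn ltcus.
- by rewrite !size_rcons szE.
- by apply/dominated_rcons; [case/andP: ltd | case/andP: ltcus | split].
Qed.

Lemma form_vee (c : nat) (es us : seq nat) :
  pairwise ltn (c :: es) -> pairwise ltn (c :: us) -> size es = size us ->
  dominated es us -> vee (rev es ++ c :: us).
Proof.
elim/last_ind: es us => [|es d IH] us.
  by case: us => // *; exact: VeeLeaf.
case/lastP: us => [|us m]; rewrite !size_rcons //.
rewrite -(rcons_cons c es) -(rcons_cons c us) !pairwise_rcons_ltn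
  => /andP[ltd ces] /andP[ltm cus] [sz].
have [_ ltd'] := andP ltd; have [_ ltm'] := andP ltm.
move=> /(dominated_rcons ltd' ltm')[dm dom].
have -> : rev (rcons es d) ++ c :: rcons us m = d :: rcons (rev es ++ c :: us)
  m.
  by rewrite rev_rcons rcons_cat.
apply: VeeWrap.
- exact: IH.
- case/lastP: es ltd {IH ces sz ltd' dom} => [|es e]; first by case/andP.
  by rewrite rev_rcons -rcons_cons all_rcons => /andP[].
- rewrite /= dm all_cat ltm andbT all_rev.
  by apply: sub_all ltd' => x /ltn_trans; apply.
Qed.

(** Here [xs] is the right arm of the inner vee, [z] the notch, [g] the letter closing it, and [ys]
    collects the later wraps. Since [g] comes with no first letter, it stays out of the
    domination. *)
Lemma notched_form (w : seq nat) : notched w -> exists c es xs z g ys,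
  [/\ w = rev es ++ c :: xs ++ [:: z, g & ys], z < c /\ pairwise ltn (c :: es),
      pairwise ltn (c :: xs ++ g :: ys), size es = size (xs ++ ys)
      & dominated es (xs ++ ys)].
Proof.
elim=> [A b m /vee_form[c [es [us [-> ces cus szE dom]]]] ltb ltm|].
  exists c, es, us, b, m, [::]; rewrite cats0; split=> //.
  - by rewrite -!cats1 -!catA.
  - by split=> //; apply: (allP ltb); rewrite mem_cat mem_head orbT.
  - rewrite cats1 -rcons_cons pairwise_rcons_ltn cus andbT.
    by move: ltm; rewrite all_rcons all_cat => /and3P[].
move=> d u m _ [c [es [xs [z [g [ys [-> [zc ces] cus szE dom]]]]]]] hd ltm.
have ltd : all (fun x => x < d) (c :: es).
  case/lastP: es ces hd {szE dom ltm} => [|es e] /=; first by move=> _ ->.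
  rewrite rev_rcons /= pairwise_rcons_ltn all_rcons.
  move=> /andP[/andP[ce _] /andP[lte _]] ed.
  rewrite all_rcons ed (ltn_trans ce) //=.
  by apply: sub_all lte => x /ltn_trans; apply.
have [dm ltm'] : d < m /\ all (fun x => x < m) (c :: xs ++ g :: ys).
  move: ltm; rewrite /= all_cat /= !all_cat /=.
  by move=> /and5P[-> _ -> -> /and3P[_ -> ->]].
exists c, (rcons es d), xs, z, g, (rcons ys m); split.
- by rewrite rev_rcons !rcons_cat /= rcons_cat.
- by rewrite -rcons_cons pairwise_rcons_ltn ltd.
- by rewrite -(rcons_cons g) -rcons_cat -rcons_cons pairwise_rcons_ltn ltm'.
- by rewrite -rcons_cat !size_rcons szE.
rewrite -rcons_cat; apply/dominated_rcons; [by case/andP: ltd | | by split].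
by move: ltm'; rewrite /= !all_cat /= => /and4P[_ -> _ ->].
Qed.

Lemma dominated_lt (es us : seq nat) (e : nat) :
  dominated es us -> e \in es -> exists2 u, u \in us & e < u.
Proof.
move=> dom ee; apply/hasP; rewrite has_count.
by apply: leq_trans (dom e); rewrite -has_count; apply/hasP; exists e.
Qed.

Lemma form_notched (c z g : nat) (es xs ys : seq nat) :
  z < c -> pairwise ltn (c :: es) -> pairwise ltn (c :: xs ++ g :: ys) ->
  size es = size (xs ++ ys) -> dominated es (xs ++ ys) ->
  notched (rev es ++ c :: xs ++ [:: z, g & ys]).
Proof.
move=> zc; elim/last_ind: ys es => [|ys m IH] es ces cus sz dom.
  rewrite cats0 in sz dom.
  rewrite cats1 -rcons_cons pairwise_rcons_ltn in cus.
  have [ltg cus'] := andP cus.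
  have := form_vee ces cus' sz dom => vA.
  have -> : rev es ++ c :: xs ++ [:: z;
    g] = rcons (rcons (rev es ++ c :: xs) z) g.
    by rewrite -!cats1 -!catA.
  have [cg ltxs] : c < g /\ all (fun x => x < g) xs by apply/andP.
  have [ltes ltus] : all (ltn c) es /\ all (ltn c) xs.
    by case/andP: ces; case/andP: cus'.
  apply: NotchedVee => //.
    rewrite all_cat /= all_rev zc /=; apply/andP.
    by split; [apply: sub_all ltes | apply: sub_all ltus] => x;
      apply: ltn_trans.
  rewrite all_rcons (ltn_trans zc cg) all_cat all_rev /= cg ltxs !andbT.
  (* The letters of [es] lie below [g] because each is below some letter of [xs]. *)
  apply/allP => e /(dominated_lt dom)[u /(allP ltxs) ug eu].
  exact: ltn_trans eu ug.
have eus : xs ++ rcons ys m = rcons (xs ++ ys) m by rewrite rcons_cat.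
rewrite eus size_rcons in sz dom; case/lastP: es ces sz dom => // es d.
have -> : rev (rcons es d) ++ c :: xs ++ [:: z, g & rcons ys m] =
    d :: rcons (rev es ++ c :: xs ++ [:: z, g & ys]) m.
  by rewrite rev_rcons !rcons_cat /= rcons_cat.
have ecus : c :: xs ++ g :: rcons ys m = rcons (c :: xs ++ g :: ys) m.
  by rewrite rcons_cons rcons_cat.
rewrite ecus pairwise_rcons_ltn in cus; case/andP: cus => ltm cus.
rewrite -rcons_cons pairwise_rcons_ltn size_rcons => /andP[ltd ces] [sz].
have ltd' : all (fun x => x < d) es by case/andP: ltd.
have ltm' : all (fun x => x < m) (xs ++ ys).
  by move: ltm; rewrite /= !all_cat /= => /and4P[_ -> _ ->].
have cm : c < m by case/andP: ltm.
case/(dominated_rcons ltd' ltm') => dm dom; apply: NotchedWrap.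
- exact: IH.
- case/lastP: es ltd {IH ces sz ltd' dom} => [|es e]; first by case/andP.
  by rewrite rev_rcons -rcons_cons all_rcons => /andP[].
- move: ltm; rewrite /= dm !all_cat /= !all_cat /= all_rev (ltn_trans zc cm).
  case/and4P=> -> -> -> ->; rewrite !andbT.
  by apply: sub_all ltd' => x /ltn_trans; apply.
Qed.

(** A three-colouring of the interval of values from [c] on: read from the largest value down, [us]
    and [es] form a ballot sequence, and [gs] marks neutral positions. *)
Definition coloured (c a b e : nat) (t : seq nat * seq nat * seq nat) : Prop :=
  let: (es, us, gs) := t in
  [/\ [/\ size es = a, size us = b & size gs = e],
      [/\ pairwise ltn es, pairwise ltn us & pairwise ltn gs],
      perm_eq (es ++ us ++ gs) (iota c (a + b + e)) & dominated es us].

(** * Recursion on the smallest value *)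

Lemma pairwise_head (c : nat) (s : seq nat) :
  pairwise ltn s -> all (leq c) s -> c \in s -> s = c :: behead s.
Proof.
case: s => //= x s /andP[ltx _] /andP[cx _]; rewrite inE => /predU1P[-> //|].
by move/(allP ltx); rewrite /= ltnNge cx.
Qed.

Lemma coloured_leq (c a b e : nat) (es us gs : seq nat) :
  coloured c a b e (es, us, gs) -> all (leq c) (es ++ us ++ gs).
Proof.
case=> _ _ pm _; rewrite (perm_all _ pm); apply/allP => x.
by rewrite mem_iota => /andP[].
Qed.

Lemma perm_iota_consE (c n : nat) (s t : seq nat) :
  perm_eq s (c :: t) -> perm_eq s (iota c n.+1) = perm_eq t (iota c.+1 n).
Proof. by move=> /permPl->; rewrite /= perm_cons. Qed.

Lemma count_all_size (T : Type) (p : pred T) (s : seq T) :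
  all p s -> count p s = size s.
Proof. by rewrite all_count => /eqP. Qed.

(** Only thresholds up to [c] notice the new entry. There all [b] entries of [us] count, so [a < b]
    is exactly what is required. *)
Lemma coloured_es (c a b e : nat) (es us gs : seq nat) : a < b ->
  coloured c a.+1 b e (c :: es, us, gs) <->
  coloured c.+1 a b e (es, us, gs).
Proof.
move=> ab; split=> [[[[sa] sb se] [pe pu pg] pm dom]|col].
  have pm' : perm_eq (es ++ us ++ gs) (iota c.+1 (a + b + e)).
    by move: pm; rewrite !addSn /= perm_cons.
  split=> //; first by case/andP: pe.
  by move=> v; apply: leq_trans (dom v); rewrite /= leq_addl.
have := coloured_leq col; rewrite !all_cat => /and3P[lee leu leg].
case: col => [[sa sb se] [pe pu pg] pm dom]; split.
- by rewrite /= sa.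
- by split; rewrite //= pe andbT.
- by rewrite !addSn /= perm_cons.
move=> v /=; case: (leqP v c) => vc; last exact: (dom v).
rewrite (@count_all_size _ (ltn v) us).
  by rewrite sb (leq_ltn_trans (count_size _ _)) // sa.
by apply: sub_all leu => x; apply: leq_ltn_trans.
Qed.

Lemma coloured_us (c a b e : nat) (es us gs : seq nat) :
  coloured c a b.+1 e (es, c :: us, gs) <->
  coloured c.+1 a b e (es, us, gs).
Proof.
have pE : perm_eq (es ++ (c :: us) ++ gs) (c :: es ++ us ++ gs).
  by rewrite -(cat1s c us) -catA perm_catCA.
have nE : a + b.+1 + e = (a + b + e).+1 by rewrite addnS.
split=> [[[sa [sb] se] [pe pu pg] pm dom]|col].
  rewrite nE (perm_iota_consE _ pE) in pm.
  have col' : all (leq c.+1) es.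
    apply/allP => x xe; have : x \in es ++ us ++ gs by rewrite mem_cat xe.
    by rewrite (perm_mem pm) mem_iota => /andP[].
  split=> //; first by split=> //; case/andP: pu.
  move=> v; case: (leqP v c) => vc; last first.
    by have := dom v; rewrite /= ltnNge (ltnW vc).
  (* Removing [c] matters only at thresholds below [c], but domination at [c] itself already bounds
     the size of [es] by the number of entries of [us] above [c]. *)
  have := dom c; rewrite /= ltnn add0n.
  rewrite (@count_all_size _ (leq c)); last first.
    by apply: sub_all col' => x; apply: ltnW.
  move=> le1; apply: leq_trans (count_size _ _) (leq_trans le1 _).
  by apply: sub_count => x; apply: leq_ltn_trans.
have := coloured_leq col; rewrite !all_cat => /and3P[lee leu leg].
case: col => [[sa sb se] [pe pu pg] pm dom]; split.
- by rewrite /= sb.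
- by split; rewrite //= pu andbT.
- by rewrite nE (perm_iota_consE _ pE).
by move=> v; apply: leq_trans (dom v) _; rewrite /= leq_addl.
Qed.

Lemma coloured_gs (c a b e : nat) (es us gs : seq nat) :
  coloured c a b e.+1 (es, us, c :: gs) <->
  coloured c.+1 a b e (es, us, gs).
Proof.
have pE : perm_eq (es ++ us ++ c :: gs) (c :: es ++ us ++ gs).
  by rewrite -(cat1s c gs) !(catA es us) perm_catCA.
split=> [[[sa sb [se]] [pe pu pg] pm dom]|col].
  rewrite addnS (perm_iota_consE _ pE) in pm.
  by split=> //; split=> //; case/andP: pg.
have := coloured_leq col; rewrite !all_cat => /and3P[lee leu leg].
case: col => [[sa sb se] [pe pu pg] pm dom]; split=> //.
- by rewrite /= se.
- by split; rewrite //= pg andbT.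
- by rewrite addnS (perm_iota_consE _ pE).
Qed.

(* The smallest value [c] heads one of the three sequences. The resulting Pascal
   recursion is solved by the reflection formula C(a+b, a) - C(a+b, a-1), stated
   without subtraction; [a = b + 1] is its boundary case, with no triples. *)
Lemma coloured_enum (n c a b e : nat) : a + b + e = n -> a <= b.+1 ->
  exists l, [/\ uniq l, forall t, t \in l <-> coloured c a b e t
    & size l + 'C(n, e) * (if a is a'.+1 then 'C(a + b, a') else 0)
      = 'C(n, e) * 'C(a + b, a)].
Proof.
elim: n c a b e => [|n IH] c a b e.
  case: a => //; case: b => //; case: e => // _ _.
  exists [:: ([::], [::], [::])]; split=> // -[[es us] gs]; rewrite inE.
  split=> [/eqP[-> -> ->] //|[[]]].
  by case: es => //; case: us => //; case: gs.
move=> sn; rewrite leq_eqVlt => /predU1P[ab|ab].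
  (* Threshold 0 would give [a <= b], so there is no triple; the two binomials agree by symmetry. *)
  exists [::]; split=> // [[[es us] gs]|].
    split=> // -[[sa sb _] _ _ /(_ 0)].
    rewrite (@count_all_size _ (leq 0)) ?all_predT //.
    by have := count_size (ltn 0) us; lia.
  rewrite ab add0n; congr (_ * _); rewrite -bin_sub; last by lia.
  by congr 'C(_, _); lia.
(* Three lists follow, according to whether [c] heads [es], [us] or [gs]; each comes from the
   induction hypothesis with one size lowered. *)
have [lD [uD mD sD]] : exists l, [/\ uniq l,
    forall t, t \in l <-> coloured c a b e t /\ c \in t.1.1
    & size l + 'C(n, e) *
        (if a is a'.+2 then 'C(a'.+1 + b, a') else 0) =
      'C(n, e) * (if a is a'.+1 then 'C(a' + b, a') else 0)].
  case: a sn ab => [|a] sn ab.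
    exists [::]; split=> // -[[es us] gs].
    by split=> // -[[[/size0nil->]]].
  have [l [ul ml sl]] := IH c.+1 a b e ltac:(lia) ltac:(lia).
  exists [seq (c :: t.1.1, t.1.2, t.2) | t <- l]; split.
  - by rewrite map_inj_uniq // => -[[? ?] ?] [[? ?] ?] [-> -> ->].
  - move=> [[es us] gs]; split=> [/mapP[[[es' us'] gs'] /ml tl [-> -> ->]]|].
      by split; [apply/coloured_es | apply: mem_head].
    case=> /= col ce; have := coloured_leq col; rewrite all_cat => /andP[lee _].
    have pe : pairwise ltn es by case: col => _ [].
    have ee := pairwise_head pe lee ce; rewrite ee in col *.
    apply/mapP; exists (behead es, us, gs) => //.
    by apply/ml/(coloured_es _ _ _ _ _).
  - by rewrite size_map; move: sl; case: (a).
have [lU [uU mU sU]] : exists l, [/\ uniq l,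
    forall t, t \in l <-> coloured c a b e t /\ c \in t.1.2
    & size l + 'C(n, e) *
        (if (a, b) is (a'.+1, b'.+1) then 'C(a + b', a') else 0) =
      'C(n, e) * (if b is b'.+1 then 'C(a + b', a) else 0)].
  case: b sn ab IH {lD uD mD sD} => [|b] sn ab IH.
    exists [::]; split=> // [[[es us] gs]|]; last by case: (a); rewrite muln0.
    by split=> // -[[[_ /size0nil->]]].
  have [l [ul ml sl]] := IH c.+1 a b e ltac:(lia) ltac:(lia).
  exists [seq (t.1.1, c :: t.1.2, t.2) | t <- l]; split.
  - by rewrite map_inj_uniq // => -[[? ?] ?] [[? ?] ?] [-> -> ->].
  - move=> [[es us] gs]; split=> [/mapP[[[es' us'] gs'] /ml tl [-> -> ->]]|].
      by split; [apply/coloured_us | apply: mem_head].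
    case=> /= col ce; have := coloured_leq col.
    rewrite !all_cat => /and3P[_ leu _].
    have pu : pairwise ltn us by case: col => _ [].
    have ee := pairwise_head pu leu ce; rewrite ee in col *.
    apply/mapP; exists (es, behead us, gs) => //.
    by apply/ml/(coloured_us _ _ _ _ _).
  - by rewrite size_map; move: sl; case: (a).
have [lE [uE mE sE]] : exists l, [/\ uniq l,
    forall t, t \in l <-> coloured c a b e t /\ c \in t.2
    & size l + (if e is e'.+1 then 'C(n, e') else 0) *
        (if a is a'.+1 then 'C(a + b, a') else 0) =
      (if e is e'.+1 then 'C(n, e') else 0) * 'C(a + b, a)].
  case: e sn IH {lD uD mD sD lU uU mU sU} => [|e] sn IH.
    exists [::]; split=> // -[[es us] gs].
    by split=> // -[[[_ _ /size0nil->]]].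
  have [l [ul ml sl]] := IH c.+1 a b e ltac:(lia) ltac:(lia).
  exists [seq (t.1.1, t.1.2, c :: t.2) | t <- l]; split.
  - by rewrite map_inj_uniq // => -[[? ?] ?] [[? ?] ?] [-> -> ->].
  - move=> [[es us] gs]; split=> [/mapP[[[es' us'] gs'] /ml tl [-> -> ->]]|].
      by split; [apply/coloured_gs | apply: mem_head].
    case=> /= col ce; have := coloured_leq col.
    rewrite !all_cat => /and3P[_ _ leg].
    have pg : pairwise ltn gs by case: col => _ [].
    have ee := pairwise_head pg leg ce; rewrite ee in col *.
    apply/mapP; exists (es, us, behead gs) => //.
    by apply/ml/(coloured_gs _ _ _ _ _).
  - by rewrite size_map.
have disj es us gs : coloured c a b e (es, us, gs) -> uniq (es ++ us ++ gs).
  by case=> _ _ /perm_uniq-> _; apply: iota_uniq.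
exists (lD ++ lU ++ lE); split.
- rewrite !cat_uniq uD uU uE /= andbT; apply/andP; split.
    apply/hasPn => -[[es us] gs]; rewrite mem_cat => tUE.
    apply/negP => /mD[/disj + /= ce]; rewrite cat_uniq => /and3P[_ /hasPn no _].
    suff /no : c \in us ++ gs by rewrite ce.
    by rewrite mem_cat; case/orP: tUE => [/mU[_ /= ->]|/mE[_ /= ->]];
      rewrite ?orbT.
  apply/hasPn => -[[es us] gs] /mE[/disj + /= cg].
  rewrite cat_uniq => /and3P[_ _]; rewrite cat_uniq => /and3P[_ /hasPn no _].
  by apply/negP => /mU[_ /= cu]; move: (no _ cg); rewrite cu.
- move=> [[es us] gs]; rewrite !mem_cat; split.
    by case/or3P=> [/mD[]|/mU[]|/mE[]].
  move=> col; have : c \in es ++ us ++ gs.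
    by case: (col) => _ _ pm _; rewrite (perm_mem pm) sn mem_head.
  rewrite !mem_cat => /or3P[ce|cu|cg]; apply/or3P.
  + by constructor 1; apply/mD.
  + by constructor 2; apply/mU.
  + by constructor 3; apply/mE.
(* The three counts add up by Pascal's rule, once for the choice of neutral positions and once for
   each of the two ballot binomials. *)
rewrite !size_cat.
have eC : 'C(n.+1, e) = 'C(n, e) + (if e is e'.+1 then 'C(n, e') else 0).
  by case: (e) => [|e']; rewrite ?bin0 ?binS.
rewrite eC; case: a ab sn sD sU sE {eC mD mU mE disj} => [|a] ab sn.
  case: b ab sn => [|b] _ sn /=; rewrite !bin0; last by lia.
  by rewrite bin_small; lia.
case: b ab sn => [|b] //= _ _; rewrite !addSn !addnS.
case: a => [|a]; first by rewrite !bin0 !bin1; nia.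
by rewrite !(addSn, addnS) !binS; nia.
Qed.

(** The count is (2j+1)(C(2j, j) - C(2j, j-1)), that is (2j+1) Cat(j), which equals C(2j+1, j+1). *)
Lemma coloured_enum1 (j c : nat) :
  exists l, [/\ uniq l, forall t, t \in l <-> coloured c j j 1 t
               & size l = 'C(j.*2.+1, j.+1)].
Proof.
have [l [ul ml sl]] :=
  @coloured_enum (j.*2.+1) c j j 1 ltac:(lia) (leqnSn j).
exists l; split=> //; move: sl; rewrite bin1 addnn.
have := mul_bin_diag j.*2.+1 j.
case: j {ml} => [|j] /=; first by rewrite !muln0 !bin0; lia.
have := mul_bin_left j.+1.*2 j.
have -> : j.+1.*2 - j = j.+2 by lia.
nia.
Qed.

(** * Enumeration *)

Lemma wordE (n : nat) (p : 'S_n) :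
  word p = [seq x.+1 | x <- map val (map p (enum 'I_n))].
Proof. by rewrite /word -!map_comp. Qed.

Lemma word_inj (n : nat) : injective (@word n).
Proof.
move=> p q /eq_in_map e; apply/permP => i.
by apply: val_inj; have [] := e i (mem_enum _ i).
Qed.

Lemma word_perm (n : nat) (p : 'S_n) : perm_eq (word p) (iota 1 n).
Proof.
rewrite wordE -[1]/(1 + 0) iotaDl -val_enum_ord; do 2!apply: perm_map.
apply: uniq_perm; rewrite ?(map_inj_uniq perm_inj) ?enum_uniq // => i.
rewrite mem_enum; apply/mapP; exists (p^-1%g i); rewrite ?mem_enum //.
by rewrite permKV.
Qed.

Lemma word_uniq (n : nat) (p : 'S_n) : uniq (word p).
Proof. by rewrite (perm_uniq (word_perm p)) iota_uniq. Qed.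

Lemma word_surj (n : nat) (w : seq nat) :
  perm_eq w (iota 1 n) -> exists p : 'S_n, word p = w.
Proof.
case: n => [|n] pw.
  exists 1%g; rewrite (size0nil (perm_size pw)).
  by apply: size0nil; rewrite size_map size_enum_ord.
have sw : size w = n.+1 by rewrite (perm_size pw) size_iota.
have uw : uniq w by rewrite (perm_uniq pw) iota_uniq.
have wi (i : 'I_n.+1) : 0 < nth 0 w i <= n.+1.
  have : nth 0 w i \in w by rewrite mem_nth // sw.
  by rewrite (perm_mem pw) mem_iota; lia.
pose f (i : 'I_n.+1) : 'I_n.+1 := inord (nth 0 w i).-1.
have fE i : (f i).+1 = nth 0 w i by rewrite inordK; have := wi i; lia.
have f_inj : injective f.
  move=> i j /(congr1 (fun k : 'I_n.+1 => k.+1)); rewrite !fE => /eqP.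
  by rewrite nth_uniq ?sw // => /eqP/val_inj.
exists (perm f_inj); apply: (@eq_from_nth _ 0);
  rewrite size_map size_enum_ord //.
move=> i lti; rewrite (nth_map ord0) ?size_enum_ord // permE fE.
by rewrite nth_enum_ord.
Qed.

(** Since s only rearranges letters, every duplicate-free preimage of [word p] is itself the word of
    a permutation of the same size. *)
Lemma uniquely_sortedE (n : nat) (p : 'S_n) :
  uniquely_sorted p <-> unique_preimage (word p).
Proof.
have lift v : uniq v -> stack_sort v = word p -> exists q : 'S_n, word q = v.
  move=> uv sv; apply: word_surj.
  by have := stack_sort_perm uv; rewrite sv perm_sym => /perm_trans->//;
    exact: word_perm.
split=> [/cards1P[q0 eq0]|[[v uv sv] un]].
  have sq0 : stack_sort (word q0) = word p.
    by have := set11 q0; rewrite -eq0 inE => /eqP.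
  split; first by exists (word q0); first exact: word_uniq.
  have one v : uniq v -> stack_sort v = word p -> v = word q0.
    move=> uv sv; have [q qv] := lift v uv sv.
    have : q \in [set q0] by rewrite -eq0 inE qv sv.
    by rewrite inE -qv => /eqP->.
  by move=> v1 v2 u1 u2 /(one _ u1)-> /(one _ u2)->.
have [q qv] := lift v uv sv.
apply/cards1P; exists q; apply/setP => q'; rewrite !inE;
  apply/eqP/eqP => [sq|->].
  by apply: word_inj; rewrite qv; apply: un => //; exact: word_uniq.
by rewrite qv.
Qed.

(** The explicit notched form with minimum 2 and notch 1. For a singleton [gs] its letter g splits
    [us] into the x's before the notch and the y's after it. *)
Definition assemble (t : seq nat * seq nat * seq nat) : seq nat :=
  let: (es, us, gs) := t in
  rev es ++ 2 :: [seq u <- us | u < head 0 gs] ++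
  1 :: gs ++ [seq u <- us | head 0 gs < u].

Lemma filter_none (T : eqType) (P : pred T) (s : seq T) :
  all (predC P) s -> filter P s = [::].
Proof. by rewrite all_predC has_filter negbK => /eqP. Qed.

Lemma filter_ltn (g : nat) (xs ys : seq nat) : pairwise ltn (xs ++ g :: ys) ->
  [seq u <- xs ++ ys | u < g] = xs /\ [seq u <- xs ++ ys | g < u] = ys.
Proof.
rewrite pairwise_cat /= allrel_consr => /and4P[/andP[ltx _] _ lty _].
have gx : [seq u <- xs | g < u] = [::].
  by apply: filter_none; apply: sub_all ltx => x; rewrite /= -leqNgt => /ltnW.
have yg : [seq u <- ys | u < g] = [::].
  by apply: filter_none; apply: sub_all lty => x; rewrite /= -leqNgt => /ltnW.
rewrite !filter_cat gx yg cats0; split; apply/all_filterP; last exact: lty.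
exact: ltx.
Qed.

Lemma filter_split (g : nat) (us : seq nat) : pairwise ltn us -> g \notin us ->
  us = [seq u <- us | u < g] ++ [seq u <- us | g < u].
Proof.
elim: us => //= u us IH /andP[ltu pus]; rewrite inE negb_or => /andP[gu gus].
case: (ltngtP u g) gu => // [ug _|gu _] /=; first by rewrite -IH.
have /all_filterP-> : all (ltn g) us by apply: sub_all ltu => x;
  apply: ltn_trans.
suff -> : [seq x <- us | x < g] = [::] by [].
by apply: filter_none; apply: sub_all ltu => x;
  rewrite /= -leqNgt => /(ltn_trans gu)/ltnW.
Qed.

Lemma coloured_single (c j : nat) (es us gs : seq nat) :
  coloured c j j 1 (es, us, gs) -> exists2 g, gs = [:: g] & g \notin us.
Proof.
case=> [[_ _ sg] _ pm _]; case: gs sg pm => [|g [|]] // _ pm; exists g => //.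
have := perm_uniq pm; rewrite iota_uniq !cat_uniq /= => /and3P[_ _].
by rewrite orbF andbT => /andP[].
Qed.

Lemma notched_coloured (j : nat) (w : seq nat) :
  perm_eq w (iota 1 j.*2.+3) -> notched w ->
  exists2 t, coloured 3 j j 1 t & assemble t = w.
Proof.
move=> pw /notched_form[c [es [xs [z [g [ys [ew [zc ces] cus szE dom]]]]]]].
have pE : perm_eq w (z :: c :: es ++ (xs ++ ys) ++ [:: g]).
  rewrite ew; apply/seq.permP => P;
    rewrite /= !count_cat /= !count_cat /= count_rev.
  lia.
have [ltes ltus] : all (ltn c) es /\ all (ltn c) ((xs ++ ys) ++ [:: g]).
  split; first by case/andP: ces.
  case/andP: cus => + _; rewrite /= !all_cat /= => /and3P[-> -> ->] //.
have pI : perm_eq (z :: c :: es ++ (xs ++ ys) ++ [:: g]) (iota 1 j.*2.+3).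
  by rewrite -(permPl pE).
have ltr x : x \in es ++ (xs ++ ys) ++ [:: g] -> c < x.
  by rewrite mem_cat => /orP[/(allP ltes)|/(allP ltus)].
(* The letter [z] is below [c], and [c] is below all the others, so they are 1 and 2; the remaining
   values start at 3. *)
have z1 : z = 1.
  have : z \in iota 1 j.*2.+3 by rewrite -(perm_mem pI) mem_head.
  have : 1 \in z :: c :: es ++ (xs ++ ys) ++ [:: g] by rewrite (perm_mem pI).
  by rewrite mem_iota 2!in_cons => /or3P[/eqP|/eqP|/ltr]; lia.
rewrite z1 /= perm_cons in pI.
have c2 : c = 2.
  have : 2 \in c :: es ++ (xs ++ ys) ++ [:: g] by rewrite (perm_mem pI).
  by rewrite in_cons => /orP[/eqP|/ltr]; lia.
rewrite c2 /= perm_cons in pI.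
have sz := perm_size pI; rewrite !size_cat /= size_iota in sz.
rewrite size_cat in szE.
exists (es, xs ++ ys, [:: g]).
  split=> //.
  - by rewrite size_cat; split=> //; lia.
  - split=> //; first by case/andP: ces.
    case/andP: cus => _; apply: subseq_pairwise.
    by apply: cat_subseq => //; apply: subseq_cons.
  - by have -> : j + j + 1 = j.*2.+1 by lia.
have pxy : pairwise ltn (xs ++ g :: ys) by case/andP: cus.
by rewrite /= !(filter_ltn pxy).1 (filter_ltn pxy).2 ew z1 c2.
Qed.

Lemma coloured_notched (j : nat) (t : seq nat * seq nat * seq nat) :
  coloured 3 j j 1 t ->
  notched (assemble t) /\ perm_eq (assemble t) (iota 1 j.*2.+3).
Proof.
case: t => [[es us] gs] col; have [g eg gus] := coloured_single col.
have [lee leu leg] : [/\ all (leq 3) es, all (leq 3) us & 3 <= g].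
  by have := coloured_leq col; rewrite eg !all_cat /= andbT => /and3P[].
case: col => [[sa sb _] [pe pu _] pm dom]; rewrite eg in pm *.
have -> : assemble (es, us, [:: g]) = rev es ++ 2 ::
  [seq u <- us | u < g] ++ [:: 1, g & [seq u <- us | g < u]] by [].
have := filter_split pu gus.
set xs := [seq u <- us | u < g]; set ys := [seq u <- us | g < u] => eus.
have ltxs : all (fun x => x < g) xs by apply: filter_all.
have ltys : all (ltn g) ys by apply: filter_all.
split.
  apply: form_notched; rewrite -?eus ?sa ?sb //=.
    by rewrite lee pe.
  have:= pu; have := leu; rewrite eus all_cat pairwise_cat.
  move=> /andP[lx ly] /and3P[al px py].
  rewrite all_cat /= pairwise_cat /= allrel_consr px py lx ly leg al ltys.
  by rewrite !andbT.
have -> : iota 1 j.*2.+3 = [:: 1; 2] ++ iota 3 (j + j + 1).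
  by have -> : j + j + 1 = j.*2.+1 by lia.
apply: (@perm_trans _ ([:: 1; 2] ++ (es ++ us ++ [:: g]))); last first.
  by rewrite perm_cat2l.
apply/seq.permP => P.
by rewrite [in RHS]eus /= !count_cat /= !count_cat /= count_rev; lia.
Qed.

(** The first [j] letters give [es]. The letter 1, absent from [us], marks where the x's end, and
    the letter after it is g. *)
Lemma assemble_inj (j : nat) (t1 t2 : seq nat * seq nat * seq nat) :
  coloured 3 j j 1 t1 -> coloured 3 j j 1 t2 -> assemble t1 = assemble t2 ->
  t1 = t2.
Proof.
case: t1 t2 => [[es1 us1] gs1] [[es2 us2] gs2] col1 col2.
have [g1 eg1 gus1] := coloured_single col1.
have [g2 eg2 gus2] := coloured_single col2.
have n1 es us gs : coloured 3 j j 1 (es, us, gs) -> 1 \notin us.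
  move/coloured_leq; rewrite !all_cat => /and3P[_ leu _].
  by apply/negP => /(allP leu).
have nn1 := n1 _ _ _ col1; have nn2 := n1 _ _ _ col2.
case: col1 col2 => [[sa1 _ _] [_ pu1 _] _ _] [[sa2 _ _] [_ pu2 _] _ _].
rewrite eg1 eg2 /= => /eqP; rewrite eqseq_cat ?size_rev ?sa1 ?sa2 //.
case/andP=> /eqP/(can_inj revK)-> /eqP[].
case/cat_cons_inj; rewrite ?mem_filter ?negb_and ?nn1 ?nn2 ?orbT //.
by move=> ex [eg ey];
  rewrite (filter_split pu1 gus1) (filter_split pu2 gus2) ex ey eg.
Qed.

(* Subtraction on [nat] is truncated, so for [k = 0] the right-hand side is
   'C(0, 0) = 1, which agrees with the convention binom(-1, 0) = 1. *)
Theorem theorem4p2 (k : nat) :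
  #|uniquely_sorted_avoiding (2 * k + 1) [:: [:: 1; 3; 2]; [:: 3; 4; 2; 1]]|
  = 'C(2 * k - 1, k).
Proof.
set S := uniquely_sorted_avoiding _ _.
have inS p : p \in S <-> [/\ tree_word (word p), no132 (word p) & no3421 (word
  p)].
  have w0 : word p != [::].
    by rewrite -size_eq0 (perm_size (word_perm p)) size_iota addn1.
  rewrite inE; split.
    case/andP=> /uniquely_sortedE/unique_preimage_tree-/(_ w0) ? /avoidsE[? ?].
    by split.
  case=> Gp no1 no2; apply/andP; split; last exact/avoidsE.
  exact/uniquely_sortedE/tree_unique_preimage/word_uniq.
have wp (p : 'S_(2 * k + 1)) := word_perm p.
(* For k = 0 the only word is [[:: 1]], a leaf and not a notched word, hence treated apart. *)
case: k S inS wp => [|j] S inS wp.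
  rewrite bin0; apply/eqP/cards1P; exists 1%g; apply/setP => p.
  rewrite in_set1; have wE (q : 'S_(2 * 0 + 1)) : word q = [:: 1].
    exact: perm_small_eq (wp q).
  have -> : p = 1%g by apply: word_inj; rewrite !wE.
  rewrite eqxx; apply/inS; rewrite wE; split; first exact: TreeLeaf.
  - by move=> x y z /size_subseq.
  - by move=> x y z t /size_subseq.
have [l [ul ml sl]] := coloured_enum1 j 3.
have nE : 2 * j.+1 + 1 = j.*2.+3 by lia.
have -> : 2 * j.+1 - 1 = j.*2.+1 by lia.
(* Both cardinals become lengths of duplicate-free lists of words, compared by membership. *)
rewrite -sl -(size_map assemble) cardE -(size_map (@word _)).
apply/perm_size/uniq_perm.
- by rewrite map_inj_uniq ?enum_uniq //; apply: word_inj.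
- rewrite map_inj_in_uniq // => t1 t2 /ml c1 /ml c2.
  exact: assemble_inj c1 c2.
move=> w; apply/mapP/mapP => [[p + ->]|[t /ml/coloured_notched[nw pw] ->]].
  rewrite mem_enum => /inS[Gp no1 no2].
  have [np|[m em]] := tree_notched Gp (word_uniq p) no1 no2; last first.
    have := perm_size (wp p); rewrite em size_iota /=; lia.
  have pw : perm_eq (word p) (iota 1 j.*2.+3) by rewrite -nE.
  by have [t /ml tl <-] := notched_coloured pw np; exists t.
have [p ep] : exists p : 'S_(2 * j.+1 + 1), word p = assemble t.
  by apply: word_surj; rewrite nE.
have uw : uniq (assemble t) by rewrite -ep word_uniq.
exists p => //; rewrite mem_enum; apply/inS; rewrite ep.
have [no1 no2] := notched_avoids nw uw.
by split=> //; apply: notched_tree.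
Qed.
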